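(* There is a one-to-one correspondence from the feasible solution set of the Bicluster Graph Editing Problem with Size Restriction (BGEPS) to the feasible solution set of the Manufacturing Cell Formation Problem (MCFP), for corresponding instances $G=(U,V,E)$ and $M$ with the same size parameters $s_r,s_c$. In addition, for every pair of corresponding feasible solutions, the sizes of biclusters and cells are preserved: a bicluster $B$ of the BGEPS solution corresponds to a cell of the MCFP solution containing exactly $|V(B)\cap U|$ products and $|V(B)\cap V|$ machines, where $V(B)$ is the vertex set of $B$.
   Context: A bipartite graph $G=(U,V,E)$ has non-empty disjoint stable sets $U$ and $V$ as parts, and every edge in $E$ joins a vertex of $U$ to a vertex of $V$. A bicluster graph is a bipartite graph in which every connected component is a biclique (complete bipartite graph); its connected components are its biclusters, and a single vertex is considered a bicluster. BGEPS: given $G=(U,V,E)$ and minimum sizes $s_r,s_c$, a feasible solution is a bicluster graph $G'=(U,V,E')$ on the same parts, obtained from $G$ by edge editing operations (each removing an existing edge or adding a new edge between a vertex of $U$ and a vertex of $V$), in which every bicluster has at least $s_c$ vertices in $U$ and at least $s_r$ vertices in $V$. The goal is to minimize the number of edge editing operations. MCFP: the input is a binary product-machine matrix $M$ with rows indexed by products and columns by machines; the entry for product $i$ and machine $j$ is $1$ if product $i$ is manufactured by machine $j$, and $0$ otherwise. A feasible solution is a collection of product-machine cells such that every product and every machine is allocated to exactly one cell, where every cell has at least $s_c$ products and at least $s_r$ machines. (In the version without size restrictions, cells with fewer than two products or machines, and cells without products or without machines, are allowed.) Correspondence of instances: the MCFP instance $M$ corresponding to $G=(U,V,E)$ has $U$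 as its set of products and $V$ as its set of machines, and its entry $(i,j)$ is $1$ if and only if $ij\in E$. Correspondence of solutions: product $i\in U$ and machine $j\in V$ are in the same cell of the MCFP solution if and only if the vertices $i$ and $j$ belong to the same bicluster of the BGEPS solution.
   Formalization: The minimum sizes s_r and s_c are assumed to be at least 1; with a zero size the claim fails, e.g. for |U|=3, |V|=1, s_c=1, s_r=0 there are 7 feasible BGEPS solutions but 10 feasible MCFP solutions. *)

(* Defs.v *)
From HB Require Import structures.
From mathcomp Require Import all_boot.

Set Implicit Arguments.
Unset Strict Implicit.
Unset Printing Implicit Defensive.

(* A bipartite graph with parts U and V is given by its edge set
   E : {set U * V}.  Its vertex type is the disjoint sum U + V, so the parts
   are disjoint and stable by construction; that they are non-empty has to be
   assumed separately. *)

Definition adj (U V : finType) (E : {set U * V}) : rel (U + V) :=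
  fun x y => match x, y with
  | inl u, inr v => (u, v) \in E
  | inr v, inl u => (u, v) \in E
  | _, _ => false
  end.

Definition components (U V : finType) (E : {set U * V}) : {set {set U + V}} :=
  equivalence_partition (connect (adj E)) [set: U + V].

(* For vertex sets of graphs and for cells alike. *)
Definition left_part (U V : finType) (B : {set U + V}) : {set U} :=
  [set u | inl u \in B].

Definition right_part (U V : finType) (B : {set U + V}) : {set V} :=
  [set v | inr v \in B].

(* An isolated vertex satisfies this vacuously, hence is a bicluster. *)
Definition is_biclique (U V : finType) (E : {set U * V}) (B : {set U + V}) :
    bool :=
  [forall u in left_part B, forall v in right_part B, (u, v) \in E].

Definition bicluster_graph (U V : finType) (E : {set U * V}) : bool :=
  [forall B in components E, is_biclique E B].

Definition edit_step (U V : finType) : rel {set U * V} :=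
  fun E E' => [exists e, (e \in E) && (E' == E :\ e)
                      || (e \notin E) && (E' == e |: E)].

(* s_c bounds the number of elements in U (products), and s_r the number of
   elements in V (machines). *)
Definition min_sizes (U V : finType) (s_r s_c : nat)
    (S : {set {set U + V}}) : bool :=
  [forall B in S, (s_c <= #|left_part B|) && (s_r <= #|right_part B|)].

Definition bgeps_feasible (U V : finType) (E : {set U * V}) (s_r s_c : nat)
    (E' : {set U * V}) : bool :=
  [&& connect (@edit_step U V) E E',
      bicluster_graph E' &
      min_sizes s_r s_c (components E')].

(* M (i, j) = true encodes the entry 1 in row i and column j.  The entries only
   matter for the objective of the problem: feasibility of a collection S of
   cells depends on M only through its sets of products and machines. *)
Definition mcfp_feasible (U V : finType) (M : {ffun U * V -> bool})
    (s_r s_c : nat) (S : {set {set U + V}}) : bool :=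
  partition S [set: U + V] && min_sizes s_r s_c S.

Definition corresponding_instances (U V : finType) (E : {set U * V})
    (M : {ffun U * V -> bool}) : Prop :=
  forall i j, M (i, j) = ((i, j) \in E).

Definition together (U V : finType) (S : {set {set U + V}}) (i : U) (j : V) :
    bool :=
  [exists B in S, (inl i \in B) && (inr j \in B)].

Definition corresponding_solutions (U V : finType) (E' : {set U * V})
    (S : {set {set U + V}}) : Prop :=
  forall i j, together S i j <-> together (components E') i j.

(* The correspondence of solutions, localized to one bicluster B and one
   cell C. *)
Definition corresponding_cell (U V : finType) (B C : {set U + V}) : Prop :=
  forall (i : U) (j : V),
    (inl i \in C) && (inr j \in C) <-> (inl i \in B) && (inr j \in B).

(* Main.v *)
Require Import Defs.
From HB Require Import structures.
From mathcomp Require Import all_boot.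

Set Implicit Arguments.
Unset Strict Implicit.
Unset Printing Implicit Defensive.

(** A collection of sets that partitions the vertices, each set meeting both
    sides, is determined by the pairs (i, j) in U * V lying in a common set:
    if B contains i0 and j0, then the elements of U in B are those together
    with j0, and the elements of V in B are those together with i0
    ([two_sided_partition_inj]).  Positive minimum sizes guarantee that every
    bicluster and every cell meets both sides.

    In a bicluster graph the pairs lying in a common component are exactly the
    edges ([edge_together]), so the map sending a bicluster graph to its
    components is injective.  Conversely, joining i and j whenever they share
    a cell of a partition yields a graph whose components are the cells
    ([components_edges_of]), so the map is onto; any edge set is reachable
    from any other one by edits ([connect_edit]).  Corresponding solutions
    thus have the same collection of vertex sets, and a bicluster and a cell
    correspond if and only if they are equal. *)

(** Every set of the collection contains an element of each side. *)
Definition two_sided (U V : finType) (S : {set {set U + V}}) : Prop :=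
  forall B, B \in S -> exists i j, inl i \in B /\ inr j \in B.

(** The graph in which i and j are adjacent when they share a cell of S. *)
Definition edges_of (U V : finType) (S : {set {set U + V}}) : {set U * V} :=
  [set e | together S e.1 e.2].

Lemma edit_step_sym (U V : finType) : symmetric (@edit_step U V).
Proof.
suff sub A B : @edit_step U V A B -> edit_step B A.
  by move=> A B; apply/idP/idP; apply: sub.
case/existsP=> e /orP[] /andP[eA /eqP ->]; apply/existsP; exists e.
  by rewrite setD11 setD1K ?eqxx.
by rewrite setU11 setU1K ?eqxx.
Qed.

Lemma connect_edit (U V : finType) (E E' : {set U * V}) :
  connect (@edit_step U V) E E'.
Proof.
(* Every edge set is linked to the empty one, by deleting its edges. *)
suff to0 A : connect (@edit_step U V) A set0.
  apply: connect_trans (to0 E) _.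
  by rewrite (sym_connect_sym (@edit_step_sym U V)).
have [n] := ubnP #|A|; elim: n A => // n IHn A leAn.
have [-> // | [e eA]] := set_0Vmem A.
have step : edit_step A (A :\ e) by apply/existsP; exists e; rewrite eA eqxx.
apply: connect_trans (connect1 step) (IHn _ _).
by move: leAn; rewrite (cardsD1 e) eA.
Qed.

Lemma adj_sym (U V : finType) (E : {set U * V}) : symmetric (adj E).
Proof. by case=> [u|v] [u'|v']. Qed.

Lemma connect_adj_equiv (U V : finType) (E : {set U * V}) :
  equivalence_rel (connect (adj E)).
Proof.
have sym := sym_connect_sym (adj_sym E) => x y z; split=> [|xy] //.
by rewrite (same_connect sym xy).
Qed.

Lemma components_partition (U V : finType) (E : {set U * V}) :
  partition (components E) [set: U + V].
Proof.
by apply: equivalence_partitionP => x y z _ _ _; apply: connect_adj_equiv.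
Qed.

Lemma mem_components (U V : finType) (E : {set U * V}) (x : U + V) :
  [set y | connect (adj E) x y] \in components E.
Proof.
by apply/imsetP; exists x => //; apply/setP => y; rewrite !inE.
Qed.

Lemma min_sizes_two_sided (U V : finType) (s_r s_c : nat)
    (S : {set {set U + V}}) :
  0 < s_r -> 0 < s_c -> min_sizes s_r s_c S -> two_sided S.
Proof.
move=> r0 c0 /forall_inP szS B /szS /andP[leU leV].
have /card_gt0P[i] := leq_trans c0 leU; rewrite inE => iB.
have /card_gt0P[j] := leq_trans r0 leV; rewrite inE => jB.
by exists i, j.
Qed.

Section Partitions.

Variables (U V : finType).
Implicit Types (S T : {set {set U + V}}) (B C : {set U + V}).

Lemma partition_block_eq S B C x :
  partition S [set: U + V] -> B \in S -> C \in S -> x \in B -> x \in C ->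
  B = C.
Proof.
case/and3P=> _ trivS _ BS CS xB xC.
by rewrite -(def_pblock trivS BS xB) (def_pblock trivS CS xC).
Qed.

Lemma together_inl S B i j :
  partition S [set: U + V] -> B \in S -> inr j \in B ->
  together S i j = (inl i \in B).
Proof.
move=> partS BS jB; apply/exists_inP/idP => [[C CS /andP[iC jC]]|iB].
  by rewrite (partition_block_eq partS BS CS jB jC).
by exists B; rewrite ?iB.
Qed.

Lemma together_inr S B i j :
  partition S [set: U + V] -> B \in S -> inl i \in B ->
  together S i j = (inr j \in B).
Proof.
move=> partS BS iB; apply/exists_inP/idP => [[C CS /andP[iC jC]]|jB].
  by rewrite (partition_block_eq partS BS CS iB iC).
by exists B; rewrite ?iB.
Qed.

Lemma two_sided_partition_inj S T :
  partition S [set: U + V] -> partition T [set: U + V] ->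
  two_sided S -> two_sided T ->
  (forall i j, together S i j = together T i j) -> S = T.
Proof.
suff sub S1 T1 : partition S1 [set: U + V] -> partition T1 [set: U + V] ->
    two_sided S1 -> (forall i j, together S1 i j = together T1 i j) ->
    S1 \subset T1.
  move=> pS pT tS tT eqST; apply/eqP.
  by rewrite eqEsubset !sub // => i j; rewrite eqST.
move=> pS pT tS eqST; apply/subsetP => B BS.
have [i0 [j0 [iB jB]]] := tS B BS.
have : together T1 i0 j0 by rewrite -eqST (together_inl _ pS BS jB).
case/exists_inP=> C CT /andP[iC jC].
suff -> : B = C by [].
apply/setP; case=> [i|j].
  by rewrite -(together_inl _ pS BS jB) -(together_inl _ pT CT jC).
by rewrite -(together_inr _ pS BS iB) -(together_inr _ pT CT iC).
Qed.

Lemma corresponding_cell_eq S B C :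
  partition S [set: U + V] -> two_sided S -> B \in S -> C \in S ->
  corresponding_cell B C -> B = C.
Proof.
move=> pS tS BS CS BC; have [i [j [iB jB]]] := tS B BS.
have /andP[iC _] : (inl i \in C) && (inr j \in C) by apply/BC; rewrite iB.
exact: (partition_block_eq pS BS CS iB iC).
Qed.

Lemma corresponding_cell_refl B : corresponding_cell B B.
Proof. by []. Qed.

Lemma edge_together (E : {set U * V}) i j :
  bicluster_graph E -> ((i, j) \in E) = together (components E) i j.
Proof.
move=> /forall_inP bicE; apply/idP/exists_inP => [ijE|[B BE /andP[iB jB]]].
  exists [set y | connect (adj E) (inl i) y]; first exact: mem_components.
  by rewrite !inE connect0 connect1.
have /forall_inP/(_ i) := bicE B BE; rewrite inE => /(_ iB).
by move=> /forall_inP/(_ j); rewrite inE; apply.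
Qed.

Lemma connect_edges_of S x y :
  partition S [set: U + V] -> two_sided S ->
  connect (adj (edges_of S)) x y = (y \in pblock S x).
Proof.
move=> pS tS; have /and3P[/eqP covS trivS _] := pS.
have cov z : z \in cover S by rewrite covS inE.
apply/idP/idP => [/connectP[p xp ->]|yx].
  (* Adjacent vertices share a cell, hence so do the ends of a path. *)
  elim: p x xp => [|z p IHp] x /=; first by rewrite mem_pblock.
  case/andP=> xz /IHp; suff -> : pblock S x = pblock S z by [].
  case: x z xz => [i|j] [i'|j'] //=; rewrite inE /=;
    case/exists_inP=> B BS /andP[iB jB];
    by rewrite (def_pblock trivS BS iB) (def_pblock trivS BS jB).
have BS := pblock_mem (cov x); have xB : x \in pblock S x by rewrite mem_pblock.
move: (pblock S x) BS xB yx => B BS xB yB.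
have [i [j [iB jB]]] := tS B BS.
have sym := sym_connect_sym (adj_sym (edges_of S)).
have edgeB i' j' : inl i' \in B -> inr j' \in B ->
    connect (adj (edges_of S)) (inl i') (inr j').
  move=> i'B j'B; apply: connect1.
  by rewrite /= inE /= (together_inr _ pS BS i'B).
have toi z : z \in B -> connect (adj (edges_of S)) z (inl i).
  case: z => [i'|j'] zB; last by rewrite sym edgeB.
  by apply: connect_trans (edgeB _ _ zB jB) _; rewrite sym edgeB.
apply: connect_trans (toi x xB) _.
by rewrite sym toi.
Qed.

Lemma components_edges_of S :
  partition S [set: U + V] -> two_sided S -> components (edges_of S) = S.
Proof.
move=> pS tS; rewrite -[RHS](equivalence_partition_pblock pS).
apply: eq_imset => x; apply/setP => y.
by rewrite !inE connect_edges_of.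
Qed.

Lemma bicluster_edges_of S :
  partition S [set: U + V] -> two_sided S -> bicluster_graph (edges_of S).
Proof.
move=> pS tS; apply/forall_inP => B; rewrite components_edges_of // => BS.
apply/forall_inP => i; rewrite inE => iB; apply/forall_inP => j.
by rewrite !inE /= (together_inr _ pS BS iB).
Qed.

Lemma edges_of_components (E : {set U * V}) :
  bicluster_graph E -> edges_of (components E) = E.
Proof. by move=> bicE; apply/setP => -[i j]; rewrite inE edge_together. Qed.

End Partitions.

Theorem lemma2 (U V : finType) (E : {set U * V}) (M : {ffun U * V -> bool})
    (s_r s_c : nat)
    (U_nonempty : 0 < #|U|) (V_nonempty : 0 < #|V|)
    (s_r_pos : 0 < s_r) (s_c_pos : 0 < s_c)
    (EM : corresponding_instances E M) :
  (exists phi : {E' : {set U * V} | bgeps_feasible E s_r s_c E'} ->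
                {S : {set {set U + V}} | mcfp_feasible M s_r s_c S},
     bijective phi /\
     forall E' S, phi E' = S <-> corresponding_solutions (val E') (val S))
  /\
  (forall (E' : {set U * V}) (S : {set {set U + V}}),
     bgeps_feasible E s_r s_c E' -> mcfp_feasible M s_r s_c S ->
     corresponding_solutions E' S ->
     [/\ forall B, B \in components E' ->
           exists! C, C \in S /\ corresponding_cell B C,
         forall C, C \in S ->
           exists! B, B \in components E' /\ corresponding_cell B C &
         forall B C, B \in components E' -> C \in S ->
           corresponding_cell B C ->
           #|left_part C| = #|left_part B| /\
           #|right_part C| = #|right_part B|]).
Proof.
have mcfp_of E' : bgeps_feasible E s_r s_c E' ->
    mcfp_feasible M s_r s_c (components E').
  by case/and3P=> _ _ szE; apply/andP; split=> //; apply: components_partition.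
have bgeps_of S : mcfp_feasible M s_r s_c S ->
    bgeps_feasible E s_r s_c (edges_of S).
  case/andP=> pS szS; have tS := min_sizes_two_sided s_r_pos s_c_pos szS.
  by rewrite /bgeps_feasible connect_edit bicluster_edges_of ?components_edges_of.
have sol_eq E' S : bgeps_feasible E s_r s_c E' -> mcfp_feasible M s_r s_c S ->
    corresponding_solutions E' S -> components E' = S.
  case/and3P=> _ _ szE /andP[pS szS] corr.
  apply: two_sided_partition_inj => //; first exact: components_partition.
  - exact: min_sizes_two_sided szE.
  - exact: min_sizes_two_sided szS.
  - by move=> i j; apply/idP/idP => /corr.
split.
  exists (fun E' => exist _ (components (val E')) (mcfp_of _ (valP E'))); split.
    exists (fun S => exist _ (edges_of (val S)) (bgeps_of _ (valP S))).
      case=> E' feasE; apply: val_inj => /=.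
      by apply: edges_of_components; case/and3P: feasE.
    case=> S feasS; apply: val_inj => /=; case/andP: (feasS) => pS szS.
    exact: (components_edges_of pS (min_sizes_two_sided s_r_pos s_c_pos szS)).
  move=> E' S; split=> [<- // | corr].
  by apply: val_inj; apply: sol_eq corr; apply: valP.
move=> E' S feasE feasS /(sol_eq _ _ feasE feasS) ->.
case/andP: feasS => pS /(min_sizes_two_sided s_r_pos s_c_pos) tS.
split=> [B BS|C CS|B C BS CS BC].
- exists B; split; first by split; last exact: corresponding_cell_refl.
  by move=> C [CS BC]; exact: (corresponding_cell_eq pS tS BS CS BC).
- exists C; split; first by split; last exact: corresponding_cell_refl.
  by move=> B [BS BC]; apply/esym; exact: (corresponding_cell_eq pS tS BS CS BC).
- by rewrite (corresponding_cell_eq pS tS BS CS BC).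
Qed.
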